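(* For integers $m,k\ge 1$ let \[a(m, k) = |\mathrm{ParseWords}(\mathrm{LeftTurnTree}(m, k+1), \mathrm{RightTurnTree}(k, m+1))|.\] Then for all integers $m \geq 1$, $k \geq 1$, and $n \geq k + 2$, \[|\mathrm{ParseWords}(\mathrm{LeftTurnTree}(m, n), \mathrm{RightTurnTree}(k, m + n - k))| = 2\, a(m, k).\]
   Context: A binary tree is a rooted ordered tree in which each vertex has either $0$ or $2$ children; its leaves are ordered left to right. Let $G$ be the context-free grammar with start symbols $0,1,2$ and rules $0\to 12$, $0\to 21$, $1\to 02$, $1\to 20$, $2\to 01$, $2\to 10$. An $n$-leaf binary tree $T$ parses a word $w$ of length $n$ on $\{0,1,2\}$ if there is a labeling of the vertices of $T$ by $0,1,2$ such that the leaves, from left to right, are labeled with the letters of $w$, and at every internal vertex the label of the vertex together with the labels of its left and right children form a rule of $G$ (i.e. the three labels are pairwise distinct). If $T$ parses $w$, it also parses every word obtained from $w$ by permuting the alphabet $\{0,1,2\}$. For binary trees $T_1,T_2$ with the same number of leaves, $\mathrm{ParseWords}(T_1,T_2)$ denotes the set of equivalence classes (under permutations of the alphabet $\{0,1,2\}$) of words parsed by both $T_1$ and $T_2$. The level of a vertex is its distance from the root. A path tree is a binary tree with at most two vertices on each level. For $N\ge 2$, $N$-leaf path trees correspond bijectively to words $x_1\cdots x_{N-2}$ on $\{l,r\}$: $x_j=l$ (resp. $x_j=r$) means that, of the two vertices on level $j$, the left (resp. right) one has children. $\mathrm{LeftTurnTree}(p,q)$ is the $(p+q)$-leaf path tree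 corresponding to $l^p r^{q-2}$, and $\mathrm{RightTurnTree}(p,q)$ is the $(p+q)$-leaf path tree corresponding to $r^p l^{q-2}$. *)

(* Defs.v *)
From mathcomp Require Import all_boot all_fingroup.

Set Implicit Arguments.
Unset Strict Implicit.
Unset Printing Implicit Defensive.

Inductive btree : Type := Leaf | Node of btree & btree.

(* A vertex of [Node l r] is its root [None], a vertex of [l] or one of [r]. *)
Fixpoint vertex (T : btree) : finType :=
  match T with
  | Leaf => unit
  | Node l r => option (vertex l + vertex r)%type
  end.

Definition root (T : btree) : vertex T :=
  match T with
  | Leaf => tt
  | Node _ _ => None
  end.

Definition in_left (l r : btree) (v : vertex l) : vertex (Node l r) :=
  Some (inl v).

Definition in_right (l r : btree) (v : vertex r) : vertex (Node l r) :=
  Some (inr v).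

(* From left to right. *)
Fixpoint leaves (T : btree) : seq (vertex T) :=
  match T with
  | Leaf => [:: tt]
  | Node l r => map (@in_left l r) (leaves l) ++ map (@in_right l r) (leaves r)
  end.

Definition nleaves (T : btree) : nat := size (leaves T).

Notation letter := 'I_3.

(* The six rules 0 -> 12 | 21, 1 -> 02 | 20, 2 -> 01 | 10 are exactly the
   x -> y z with x, y, z pairwise distinct. *)
Definition rule (x y z : letter) : bool := uniq [:: x; y; z].

Fixpoint derivation (T : btree) : (vertex T -> letter) -> bool :=
  match T with
  | Leaf => fun _ => true
  | Node l r => fun f =>
      [&& rule (f (root (Node l r)))
               (f (in_left r (root l))) (f (in_right l (root r))),
          derivation (fun v : vertex l => f (in_left r v))
        & derivation (fun v : vertex r => f (in_right l v))]
  end.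

(* The label of the root is unconstrained, all letters being start symbols. *)
Definition parses (T : btree) (w : seq letter) : bool :=
  [exists f : {ffun vertex T -> letter},
    (map f (leaves T) == w) && derivation f].

Definition word_class (n : nat) (w : n.-tuple letter) : {set n.-tuple letter} :=
  [set map_tuple s w | s : {perm letter}].

(* Meant for trees with the same number of leaves; [parses T2 w] forces
   [size w = nleaves T2], so the set is empty otherwise. *)
Definition ParseWords (T1 T2 : btree) : {set {set (nleaves T1).-tuple letter}} :=
  [set word_class w | w : (nleaves T1).-tuple letter
                      & parses T1 w && parses T2 w].

Inductive side : Type := Lft | Rgt.

(* The head of the word says which of the two vertices on level 1 has children;
   the tail describes the subtree at that vertex.  The empty word gives the
   tree with two leaves. *)
Fixpoint path_tree (x : seq side) : btree :=
  match x with
  | [::] => Node Leaf Leaf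
  | Lft :: x' => Node (path_tree x') Leaf
  | Rgt :: x' => Node Leaf (path_tree x')
  end.

(* For q >= 2, these trees have p + q leaves. *)
Definition LeftTurnTree (p q : nat) : btree :=
  path_tree (nseq p Lft ++ nseq (q - 2) Rgt).

Definition RightTurnTree (p q : nat) : btree :=
  path_tree (nseq p Rgt ++ nseq (q - 2) Lft).

Definition a (m k : nat) : nat :=
  #|ParseWords (LeftTurnTree m (k + 1)) (RightTurnTree k (m + 1))|.

(* Main.v *)
(** Identify the three letters with the nonzero elements of the Klein four-group.
    A rule [x -> y z] then says [x = y + z], so a tree parses a word iff the
    letters below each of its vertices have a nonzero sum.  Split a word as
    [u ++ v ++ t] with [u] of length [k] and [t] of length [m].  Both trees parse
    it iff every nonempty prefix and suffix of [v] has a nonzero sum, together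
    with a condition on [u], [t] and the sum of [v] alone.  For a prescribed
    nonzero sum [s], there is one such [v] of length 1, and there are two of each
    larger length [n - k]: the first letter is any one other than [s], and it
    determines the rest, because the partial sums alternate between the two
    letters other than [s]. *)
Require Import Defs.
From mathcomp Require Import all_boot all_fingroup.
From mathcomp Require Import ssralg.
Import GRing.Theory.

Set Implicit Arguments.
Unset Strict Implicit.
Unset Printing Implicit Defensive.

(** * Letters as nonzero elements of the Klein four-group *)

Section Klein.
Local Open Scope ring_scope.

Local Notation klein := (bool * bool)%type.

Definition klein_of (x : letter) : klein := (x != 1 :> nat, x != 0 :> nat).

(* The value at [0] is junk. *)
Definition letter_of (a : klein) : letter :=
  match a with
  | (true, false) => @Ordinal 3 0 isT
  | (false, true) => @Ordinal 3 1 isT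
  | _ => @Ordinal 3 2 isT
  end.

Arguments klein_of : simpl never.
Arguments letter_of : simpl never.

Lemma klein_ofK : cancel klein_of letter_of.
Proof. by case=> [[|[|[|x]]] ltx] //; apply: val_inj. Qed.

Lemma letter_ofK (a : klein) : a != 0 -> klein_of (letter_of a) = a.
Proof. by case: a => [[] []]. Qed.

Lemma klein_of_inj : injective klein_of.
Proof. exact: can_inj klein_ofK. Qed.

Lemma klein_of_neq0 (x : letter) : klein_of x != 0.
Proof. by case: x => [[|[|[|x]]] ltx]. Qed.

Lemma klein_addxx (a : klein) : a + a = 0.
Proof. by case: a => [[] []]. Qed.

Lemma klein_add_eq0 (a b : klein) : (a + b == 0) = (a == b).
Proof. by case: a b => [[] []] [[] []]. Qed.

(** The three nonzero elements sum to 0. Conversely, no two terms of [x = y + z] can coincide when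
    all three are nonzero. *)
Lemma rule_klein (x y z : letter) :
  rule x y z = (klein_of x == klein_of y + klein_of z).
Proof. by case: x y z => [[|[|[|x]]] ltx] [[|[|[|y]]] lty] [[|[|[|z]]] ltz]. Qed.

(** * Parsing as nonvanishing of the sums below the vertices *)

Definition wsum (w : seq letter) : klein := \sum_(x <- w) klein_of x.

Lemma wsum_cons x w : wsum (x :: w) = klein_of x + wsum w.
Proof. exact: big_cons. Qed.

Lemma wsum_cat u v : wsum (u ++ v) = wsum u + wsum v.
Proof. exact: big_cat. Qed.

Lemma wsum_nil : wsum [::] = 0.
Proof. exact: big_nil. Qed.

Lemma wsum_seq1 x : wsum [:: x] = klein_of x.
Proof. exact: big_seq1. Qed.

Fixpoint nonzero_sums (T : btree) (w : seq letter) : bool :=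
  match T with
  | Leaf => size w == 1%N
  | Node l r => [&& wsum w != 0, nonzero_sums l (take (nleaves l) w)
                  & nonzero_sums r (drop (nleaves l) w)]
  end.

Lemma nleaves_Node l r : nleaves (Node l r) = (nleaves l + nleaves r)%N.
Proof. by rewrite /nleaves /= size_cat !size_map. Qed.

Lemma nonzero_sums_size T w : nonzero_sums T w -> size w = nleaves T.
Proof.
elim: T w => [|l IHl r IHr] w /=; first by move/eqP.
case/and3P=> _ /IHl sl /IHr sr.
by rewrite -[w](cat_take_drop (nleaves l)) size_cat sl sr nleaves_Node.
Qed.

Lemma nonzero_sums_Node_cat l r u v : size u = nleaves l ->
  nonzero_sums (Node l r) (u ++ v) =
    [&& wsum (u ++ v) != 0, nonzero_sums l u & nonzero_sums r v].
Proof. by move=> su /=; rewrite -su take_size_cat // drop_size_cat. Qed.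

Lemma leaves_map_Node l r (f : vertex (Node l r) -> letter) :
  map f (leaves (Node l r)) =
    map (fun v => f (in_left r v)) (leaves l) ++
    map (fun v => f (in_right l v)) (leaves r).
Proof. by rewrite /= map_cat -!map_comp. Qed.

(** By [rule_klein], labels are forced from the leaves upwards, and a label is never zero. *)
Lemma derivation_nonzero_sums T (f : vertex T -> letter) : derivation f ->
  nonzero_sums T (map f (leaves T)) /\
  wsum (map f (leaves T)) = klein_of (f (Defs.root T)).
Proof.
elim: T f => [|l IHl r IHr] f; first by rewrite wsum_seq1.
case/and3P=> rf /IHl[nl sl] /IHr[nr sr].
move: rf; rewrite rule_klein => /eqP rf.
rewrite leaves_map_Node wsum_cat sl sr -rf; split=> //.
by rewrite nonzero_sums_Node_cat ?size_map // nl nr wsum_cat sl sr -rf klein_of_neq0.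
Qed.

Lemma nonzero_sums_derivation T w : nonzero_sums T w ->
  exists2 f : vertex T -> letter, map f (leaves T) = w & derivation f.
Proof.
elim: T w => [|l IHl r IHr] w.
  by case: w => [|x []] //= _; exists (fun=> x).
case/and3P=> w0 /IHl[fl efl dl] /IHr[fr efr dr].
pose f (v : vertex (Node l r)) : letter :=
  match v with
  | None => letter_of (wsum w)
  | Some (inl v) => fl v
  | Some (inr v) => fr v
  end.
have ef : map f (leaves (Node l r)) = w.
  by rewrite leaves_map_Node efl efr cat_take_drop.
exists f => //=; apply/and3P; split=> //.
have [_ sl] := derivation_nonzero_sums dl.
have [_ sr] := derivation_nonzero_sums dr.
by rewrite rule_klein letter_ofK // -sl -sr efl efr -wsum_cat cat_take_drop.
Qed.

Lemma eq_derivation T (f g : vertex T -> letter) :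
  f =1 g -> derivation f = derivation g.
Proof.
elim: T f g => [|l IHl r IHr] f g //= efg; rewrite !efg; congr [&& _, _ & _].
  by apply: IHl => v; apply: efg.
by apply: IHr => v; apply: efg.
Qed.

Lemma parsesE T w : parses T w = nonzero_sums T w.
Proof.
apply/existsP/idP => [[f /andP[/eqP <-]] /derivation_nonzero_sums[] //|].
case/nonzero_sums_derivation=> f efw df.
exists [ffun v => f v]; rewrite (eq_derivation (ffunE f)) df andbT -efw.
by apply/eqP/eq_map => v; rewrite ffunE.
Qed.

(** * Letter permutations and classes of words *)

Lemma derivation_perm (s : {perm letter}) T (f : vertex T -> letter) :
  derivation f -> derivation (fun v => s (f v)).
Proof.
elim: T f => //= l IHl r IHr f /and3P[rf /IHl -> /IHr ->]; rewrite !andbT.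
by move: rf; rewrite /rule -(map_inj_uniq (@perm_inj _ s)).
Qed.

Lemma parses_map (s : {perm letter}) T w : parses T w -> parses T (map s w).
Proof.
case/existsP=> f /andP[/eqP <- df]; apply/existsP; exists [ffun v => s (f v)].
rewrite (eq_derivation (ffunE _)) derivation_perm // andbT -map_comp.
by apply/eqP/eq_map => v; rewrite /= ffunE.
Qed.

(** Some vertex has two leaves as children, and their letters differ because [x + x = 0]. *)
Lemma parses_Node_neq l r w : parses (Node l r) w ->
  exists x y, [/\ x \in w, y \in w & x != y].
Proof.
rewrite parsesE; have: Node l r <> Leaf by [].
move: (Node l r) => T; elim: T w {l r} => // l IHl r IHr w _ /= /and3P[w0 nl nr].
case: l IHl nl nr => [_|l1 l2 IHl nl _]; last first.
  have [//|x [y [xw yw xy]]] := IHl _ _ nl.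
  by exists x, y; rewrite (mem_take xw) (mem_take yw).
case: r IHr => [_ _|r1 r2 IHr _ nr]; last first.
  have [//|x [y [xw yw xy]]] := IHr _ _ nr.
  by exists x, y; rewrite (mem_drop xw) (mem_drop yw).
case: w w0 => [|x [|y []]] //= w0 _; exists x, y; rewrite !inE !eqxx orbT.
split=> //; apply: contraNneq w0 => ->.
by rewrite wsum_cons wsum_seq1 klein_addxx.
Qed.

Lemma perm_letter_eq (s t : {perm letter}) x y :
  x != y -> s x = t x -> s y = t y -> s = t.
Proof.
have third (a b c d : letter) : uniq [:: a; b; c] -> uniq [:: a; b; d] -> c = d.
  case: a b c d => [[|[|[|a]]] lta] [[|[|[|b]]] ltb] [[|[|[|c]]] ltc]
    [[|[|[|d]]] ltd] //; by move=> *; apply: val_inj.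
move=> xy sx sy; apply/permP => z.
have [-> //|zx] := eqVneq z x; have [-> //|zy] := eqVneq z y.
have uxyz : uniq [:: x; y; z] by rewrite /= !inE negb_or xy eq_sym zx eq_sym zy.
apply: (third (s x) (s y)); first by rewrite -(map_inj_uniq (@perm_inj _ s)) in uxyz.
by rewrite sx sy; rewrite -(map_inj_uniq (@perm_inj _ t)) in uxyz.
Qed.

(** Two distinct letters occur in [w], so the 3! permutations give different words. *)
Lemma card_word_class l r n (w : n.-tuple letter) :
  parses (Node l r) w -> #|word_class w| = 6%N.
Proof.
case/parses_Node_neq=> x [y [xw yw xy]].
have -> : word_class w = (fun s : {perm letter} => map_tuple s w) @: [set: {perm letter}].
  by apply/setP => v; apply/imsetP/imsetP => -[s _ ->]; exists s; rewrite ?inE.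
rewrite card_imset; first by rewrite cardsT -['I_3]/'I_3 card_Sn.
move=> s t /(congr1 val)/eq_in_map est.
by apply: (perm_letter_eq xy); apply: est.
Qed.

Lemma mem_word_class n (w v : n.-tuple letter) :
  (v \in word_class w) = (word_class v == word_class w).
Proof.
apply/idP/eqP => [/imsetP[s _ ->]|<-]; last first.
  apply/imsetP; exists 1%g => //; apply: val_inj.
  by rewrite /= map_id_in // => x _; rewrite perm1.
apply/setP => u; apply/imsetP/imsetP => -[t _ ->].
  exists (s * t)%g => //; apply: val_inj; rewrite /= -map_comp.
  by apply: eq_map => x; rewrite permM.
exists (s^-1 * t)%g => //; apply: val_inj; rewrite /= -map_comp.
by apply: eq_map => x; rewrite /= permM permK.
Qed.

(** The words parsed by both trees form a union of whole classes, so classes can be counted through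
    words. *)
Lemma card_ParseWords l r T N : nleaves (Node l r) = N ->
  #|[set w : N.-tuple letter | parses (Node l r) w && parses T w]|
    = (6 * #|ParseWords (Node l r) T|)%N.
Proof.
move=> <-; set W := [set w | _]; rewrite mulnC -sum_nat_const -sum1_card.
rewrite (partition_big_imset (@word_class _)) /=.
have -> : ParseWords (Node l r) T = @word_class _ @: W.
  by apply/setP => A; apply/imsetP/imsetP => -[w Pw ->];
    exists w => //; move: Pw; rewrite !inE.
apply: eq_bigr => _ /imsetP[w wW ->]; rewrite sum1dep_card.
have /andP[p1 p2] : parses (Node l r) w && parses T w by move: wW; rewrite inE.
rewrite -(card_word_class p1); apply: eq_card => v; rewrite inE -mem_word_class.
apply: andb_idl => /imsetP[s _ ->].
by rewrite inE !parses_map.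
Qed.

(** * Sum conditions for path trees *)

Fixpoint prefix_sums_nz (a : klein) (w : seq letter) : bool :=
  if w is x :: w' then (a + klein_of x != 0) && prefix_sums_nz (a + klein_of x) w'
  else true.

(** Here [b] is the sum of what follows [w], as [a] above is the sum of what precedes it. *)
Fixpoint suffix_sums_nz (w : seq letter) (b : klein) : bool :=
  if w is x :: w' then (wsum w + b != 0) && suffix_sums_nz w' b else true.

Lemma prefix_sums_nz_cat a u v :
  prefix_sums_nz a (u ++ v) = prefix_sums_nz a u && prefix_sums_nz (a + wsum u) v.
Proof.
elim: u a => [|x u IHu] a /=; first by rewrite wsum_nil addr0.
by rewrite IHu wsum_cons addrA andbA.
Qed.

Lemma suffix_sums_nz_cat u v b :
  suffix_sums_nz (u ++ v) b = suffix_sums_nz u (wsum v + b) && suffix_sums_nz v b.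
Proof.
by elim: u => [|x u IHu] //=; rewrite IHu !wsum_cons wsum_cat !addrA andbA.
Qed.

Lemma nleaves_path_tree x : nleaves (path_tree x) = (size x).+2.
Proof.
by elim: x => [|[] x IHx] //=; rewrite nleaves_Node IHx ?addn1.
Qed.

(** Below a vertex where the path makes one of the [p] left turns lies [u] followed by a nonempty
    prefix of [t]. *)
Lemma nonzero_sums_path_Lft p x u t :
  size u = (size x).+2 -> size t = p ->
  nonzero_sums (path_tree (nseq p Lft ++ x)) (u ++ t) =
    nonzero_sums (path_tree x) u && prefix_sums_nz (wsum u) t.
Proof.
move=> su; elim: p t => [|p IHp] t; first by case: t => //; rewrite cats0 andbT.
case/lastP: t => // t z; rewrite size_rcons => -[st].
rewrite -cats1 catA [path_tree _]/= nonzero_sums_Node_cat; last first.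
  by rewrite nleaves_path_tree size_cat su st size_cat size_nseq !addSn addnC.
rewrite IHp // prefix_sums_nz_cat /= !andbT !wsum_cat wsum_seq1.
by rewrite andbC -andbA.
Qed.

Lemma nonzero_sums_path_Rgt p x u t :
  size u = p -> size t = (size x).+2 ->
  nonzero_sums (path_tree (nseq p Rgt ++ x)) (u ++ t) =
    suffix_sums_nz u (wsum t) && nonzero_sums (path_tree x) t.
Proof.
move=> + st; elim: p u => [|p IHp] [|z u] //= [su].
by rewrite take0 drop0 IHp // -wsum_cat /= !andbA.
Qed.

Lemma nonzero_sums_path_nil (x y : letter) :
  nonzero_sums (path_tree [::]) [:: x; y] = (klein_of x + klein_of y != 0).
Proof. by rewrite /= andbT wsum_cons wsum_seq1. Qed.

(** Internal vertices give the suffixes of length at least 2; a one-letter suffix has a nonzero sum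
    anyway. *)
Lemma nonzero_sums_path_nseq_Rgt q u : size u = q.+2 ->
  nonzero_sums (path_tree (nseq q Rgt)) u = suffix_sums_nz u 0.
Proof.
move=> su; rewrite -[u](cat_take_drop q) -[nseq q _]cats0.
have sd : size (drop q u) = 2%N by rewrite size_drop su -addn2 addKn.
rewrite nonzero_sums_path_Rgt ?size_takel ?su ?leqW // suffix_sums_nz_cat addr0.
congr (_ && _); case: (drop q u) sd => [|x [|y []]] // _.
rewrite nonzero_sums_path_nil /= !wsum_cons wsum_nil !addr0.
by rewrite klein_of_neq0 !andbT.
Qed.

Lemma nonzero_sums_path_nseq_Lft q u : size u = q.+2 ->
  nonzero_sums (path_tree (nseq q Lft)) u = prefix_sums_nz 0 u.
Proof.
case: u => [|x [|y u]] // [su].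
rewrite -[x :: _]/([:: x; y] ++ u) -[nseq q _]cats0.
rewrite nonzero_sums_path_Lft // nonzero_sums_path_nil /= !add0r.
by rewrite klein_of_neq0 wsum_cons wsum_seq1.
Qed.

(* The condition on [u], [t] and the sum [s] of [v] for both trees to parse
   [u ++ v ++ t]. *)
Definition outer_nz (u t : seq letter) (s : klein) : bool :=
  [&& suffix_sums_nz u s, prefix_sums_nz (wsum u + s) t,
      suffix_sums_nz u (s + wsum t) & prefix_sums_nz s t].

Definition inner_nz (v : seq letter) : bool :=
  prefix_sums_nz 0 v && suffix_sums_nz v 0.

(** The first tree tests the suffixes of [u ++ v], and [u ++ v] extended by prefixes of [t]; the
    second tests the prefixes of [v ++ t], and [v ++ t] extended by suffixes of [u]. The tests that
    cut inside [v], or stop at its ends, make up [inner_nz]. *)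
Lemma parses_turn_trees m k n u v t :
  (0 < m)%N -> (0 < k)%N -> (k < n)%N ->
  size u = k -> size v = (n - k)%N -> size t = m ->
  parses (LeftTurnTree m n) (u ++ v ++ t) &&
  parses (RightTurnTree k (m + n - k)) (u ++ v ++ t) =
    outer_nz u t (wsum v) && inner_nz v.
Proof.
move=> m0 k0 kn su sv st; rewrite !parsesE.
have n2 : (2 <= n)%N by apply: leq_trans kn.
have suv : size (u ++ v) = (n - 2).+2.
  by rewrite size_cat su sv subnKC 1?ltnW // -addn2 subnK.
have svt : size (v ++ t) = (m + n - k - 2).+2.
  rewrite size_cat sv st addnC addnBA 1?ltnW // -[RHS]addn2 subnK //.
  by rewrite -(addnBA _ (ltnW kn)) -(prednK m0) addSn ltnS addn_gt0 subn_gt0 kn orbT.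
rewrite {1}catA nonzero_sums_path_Lft ?size_nseq //.
rewrite nonzero_sums_path_nseq_Rgt //.
rewrite nonzero_sums_path_Rgt ?size_nseq // nonzero_sums_path_nseq_Lft //.
rewrite suffix_sums_nz_cat prefix_sums_nz_cat !wsum_cat addr0 add0r.
rewrite /outer_nz /inner_nz.
by do 3 case: (suffix_sums_nz _ _); do 3 case: (prefix_sums_nz _ _).
Qed.

(** * Inner words with a prescribed sum *)

(* For [d] different from [0] and [s], the only word of length [n > 0] whose
   partial sums, shifted by [d], avoid [0] and [s] until the last one, which is
   [s]. *)
Fixpoint filling (s : letter) (d : klein) (n : nat) : seq letter :=
  match n with
  | 0 => [::]
  | 1 => [:: letter_of (d + klein_of s)]
  | n'.+1 => s :: filling s (d + klein_of s) n'
  end.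

Lemma size_filling s d n : size (filling s d n) = n.
Proof. by elim: n d => [|[|n] IHn] d //=; rewrite IHn. Qed.

(** In the group [{0, s, d, d + s}], the letter [s] swaps [d] and [d + s]. Any other letter leads
    from [d] to 0, which is forbidden, or to [s], which is possible only at the end. *)
Lemma fillingP s (d : klein) v : (0 < size v)%N -> d != 0 -> d != klein_of s ->
  [&& prefix_sums_nz d v, suffix_sums_nz v 0 & d + wsum v == klein_of s] =
    (v == filling s d (size v)).
Proof.
elim: v d => // x [|y v] IHv d _ d0 ds.
  rewrite /= wsum_seq1 addr0 klein_of_neq0 /= !andbT eqseq_cons andbT.
  rewrite -(inj_eq klein_of_inj) letter_ofK ?klein_add_eq0 //.
  have := klein_of_neq0 x; have := klein_of_neq0 s; move: d0 ds.
  by case: d (klein_of x) (klein_of s) => [[] []] [[] []] [[] []].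
rewrite [filling _ _ _]/= eqseq_cons; have [->|xs] := eqVneq x s.
  have ds0 : d + klein_of s != 0 by rewrite klein_add_eq0.
  have dss : d + klein_of s != klein_of s.
    by rewrite -subr_eq0 addrK.
  rewrite -IHv // [prefix_sums_nz d _]/(_ && prefix_sums_nz _ (y :: v)).
  rewrite [suffix_sums_nz (s :: _) _]/(_ && suffix_sums_nz (y :: v) 0).
  rewrite addr0 wsum_cons addrA ds0.
  case: (d + _ + _ =P _) => [e|_]; last by rewrite !andbF.
  suff -> : klein_of s + wsum (y :: v) != 0 by rewrite !andbT.
  by apply: contra_neq ds => e'; rewrite -e -addrA e' addr0.
(* Now [d + x] is 0 or [s]: the former breaks the prefix condition, the latter makes the nonempty
   suffix [y :: v] sum to 0. *)
rewrite /=; apply/negP => /and3P[/andP[dx _] /and3P[_]].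
rewrite addr0 => v0 _; rewrite wsum_cons addrA => /eqP e.
have dxs : d + klein_of x != klein_of s.
  by rewrite -e -{1}[d + _]addr0 (inj_eq (addrI _)) eq_sym.
move: (klein_of_neq0 x) (klein_of_neq0 s) xs d0 ds dx dxs.
rewrite -(inj_eq klein_of_inj).
by case: d (klein_of x) (klein_of s) {v0 e} => [[] []] [[] []] [[] []].
Qed.

(** If [x = s], the nonempty suffix [v] would sum to 0; otherwise [x] is a valid starting shift for
    a filling. *)
Lemma inner_nz_filling s x v : (0 < size v)%N ->
  inner_nz (x :: v) && (wsum (x :: v) == klein_of s) =
    (x != s) && (v == filling s (klein_of x) (size v)).
Proof.
move=> v0; rewrite /inner_nz /= add0r klein_of_neq0 addr0 /=.
have [->|xs] := eqVneq x s.
  apply/negP => /andP[/and3P[_ _]]; case: v v0 => // y v _ /= /andP[] /[swap] _.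
  rewrite addr0 [wsum (s :: _)]wsum_cons -{2}[klein_of s]addr0.
  by rewrite (inj_eq (addrI _)) => /negPf->.
rewrite -fillingP ?klein_of_neq0 ?(inj_eq klein_of_inj) //.
rewrite wsum_cons -andbA; congr (_ && _); rewrite -andbA.
by case: (_ =P klein_of s) => [->|_]; rewrite ?andbF // klein_of_neq0.
Qed.

(** The Boolean [1 < L] counts as 0 or 1. The value 2 is the number of first letters other than
    [s]. *)
Lemma card_inner_nz (L : nat) (s : letter) : (0 < L)%N ->
  #|[set v : L.-tuple letter | inner_nz v && (wsum v == klein_of s)]|
    = (1 < L)%N.+1.
Proof.
case: L => // -[|L] _.
  rewrite -[RHS](cards1 [tuple s]); apply: eq_card => v; rewrite !inE.
  case/tupleP: v => x v; rewrite tuple0 /inner_nz /= wsum_seq1 add0r addr0 klein_of_neq0.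
  by rewrite (inj_eq klein_of_inj) -[RHS]val_eqE /= eqseq_cons andbT.
pose F x : L.+2.-tuple letter :=
  [tuple of x :: tcast (size_filling s (klein_of x) L.+1) (in_tuple _)].
have valF x : val (F x) = x :: filling s (klein_of x) L.+1.
  by rewrite /= val_tcast.
have -> : [set v : L.+2.-tuple letter | inner_nz v && (wsum v == klein_of s)]
    = F @: [set~ s].
  apply/setP => v; rewrite inE; apply/idP/imsetP.
    case/tupleP: v => x v; rewrite inner_nz_filling ?size_tuple //.
    case/andP=> xs /eqP; rewrite [size v]size_tuple => ev.
    exists x; first by rewrite !inE.
    by apply: val_inj; rewrite valF /= ev.
  case=> x; rewrite !inE => xs ->.
  by rewrite valF inner_nz_filling ?size_filling // xs eqxx.
rewrite card_imset ?cardsC1 ?card_ord // => x y /(congr1 val).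
by rewrite !valF => -[].
Qed.

(** * Counting the words parsed by both trees *)

Lemma inner_nz_wsum v : (0 < size v)%N -> inner_nz v -> wsum v != 0.
Proof. by case: v => // x v _ /andP[_ /= /andP[]]; rewrite addr0. Qed.

(** The outer condition sees [v] only through its sum, and the number of inner words is the same for
    every nonzero sum. *)
Lemma card_outer_inner_nz (k L m : nat) : (0 < L)%N ->
  #|[set p : (k.-tuple letter * m.-tuple letter) * L.-tuple letter |
      outer_nz p.1.1 p.1.2 (wsum p.2) && inner_nz p.2]|
    = ((1 < L)%N.+1 *
       #|[set c : (k.-tuple letter * m.-tuple letter) * letter |
           outer_nz c.1.1 c.1.2 (klein_of c.2)]|)%N.
Proof.
move=> L0; set Q := [set p | _]; set C := [set c | _].
pose g (p : (k.-tuple letter * m.-tuple letter) * L.-tuple letter) :=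
  (p.1, letter_of (wsum p.2)).
have wsum_letter (v : L.-tuple letter) :
    inner_nz v -> klein_of (letter_of (wsum v)) = wsum v.
  by move=> iv; rewrite letter_ofK // inner_nz_wsum ?size_tuple.
rewrite -sum1_card (partition_big g (mem C)) /=; last first.
  by move=> p; rewrite !inE /= => /andP[op ip]; rewrite wsum_letter.
rewrite mulnC -sum_nat_const; apply: eq_bigr => -[[u t] s].
rewrite inE sum1dep_card /= => oc; rewrite -(card_inner_nz s L0).
rewrite -(card_imset _ (fun v v' (e : (u, t, v) = (u, t, v')) => congr1 snd e)).
apply: eq_card => -[ut v]; rewrite !inE; apply/idP/imsetP.
  case/andP=> /andP[_ iv] /eqP[-> es]; exists v => //.
  by rewrite inE iv -es wsum_letter /=.
case=> v'; rewrite inE => /andP[iv /eqP es] [-> ->].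
by rewrite /g /= es klein_ofK oc iv eqxx.
Qed.

(** Words are cut bijectively as [u ++ v ++ t]. The last factor does not involve [n]. *)
Lemma card_turn_words m k n N : (0 < m)%N -> (0 < k)%N -> (k < n)%N ->
  (N = m + n)%N ->
  #|[set w : N.-tuple letter |
      parses (LeftTurnTree m n) w && parses (RightTurnTree k (m + n - k)) w]|
    = ((1 < n - k)%N.+1 *
       #|[set c : (k.-tuple letter * m.-tuple letter) * letter |
           outer_nz c.1.1 c.1.2 (klein_of c.2)]|)%N.
Proof.
move=> m0 k0 kn eN; have {eN} -> : (N = k + ((n - k) + m))%N.
  by rewrite eN addnA subnKC 1?ltnW // addnC.
rewrite -card_outer_inner_nz ?subn_gt0 //; set W := [set w | _].
pose f (p : (k.-tuple letter * m.-tuple letter) * (n - k).-tuple letter) :=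
  cat_tuple p.1.1 (cat_tuple p.2 p.1.2).
have f_inj : injective f.
  move=> [[u t] v] [[u' t'] v'] /(congr1 val)/eqP /=.
  rewrite eqseq_cat ?size_tuple // => /andP[/eqP/val_inj -> ].
  by rewrite eqseq_cat ?size_tuple // => /andP[/eqP/val_inj -> /eqP/val_inj ->].
rewrite -(card_imset _ f_inj); apply: eq_card => w; apply/idP/imsetP.
  have su : size (take k w) == k by rewrite size_takel // size_tuple leq_addr.
  have sd : size (drop k w) = (n - k + m)%N by rewrite size_drop size_tuple addKn.
  have sv : size (take (n - k) (drop k w)) == (n - k)%N.
    by rewrite size_takel // sd leq_addr.
  have st : size (drop (n - k) (drop k w)) == m by rewrite size_drop sd addKn.
  have ew : w = f (Tuple su, Tuple st, Tuple sv).
    by apply: val_inj; rewrite /= !cat_take_drop.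
  rewrite ew inE /= parses_turn_trees ?(eqP su) ?(eqP sv) ?(eqP st) // => pw.
  by exists (Tuple su, Tuple st, Tuple sv); rewrite ?inE.
by case=> -[[u t] v]; rewrite !inE /= => ? ->; rewrite parses_turn_trees ?size_tuple.
Qed.

End Klein.

Theorem theorem15 (m k n : nat) (hm : 1 <= m) (hk : 1 <= k) (hn : k + 2 <= n) :
  #|ParseWords (LeftTurnTree m n) (RightTurnTree k (m + n - k))| = 2 * a m k.
Proof.
(* Only the factor [(1 < n' - k).+1] varies with [n']: it is 2 at [n' = n], and 1 at [n' = k + 1],
   the case defining [a m k]. *)
have classes n' : k < n' ->
    6 * #|ParseWords (LeftTurnTree m n') (RightTurnTree k (m + n' - k))| =
    (1 < n' - k).+1 * #|[set c : (k.-tuple letter * m.-tuple letter) * letter |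
                           outer_nz c.1.1 c.1.2 (klein_of c.2)]|.
  move=> kn'; rewrite -(card_turn_words hm hk kn' erefl).
  have : nleaves (LeftTurnTree m n') = m + n'.
    rewrite nleaves_path_tree size_cat !size_nseq -!addnS -addn2 subnK //.
    exact: leq_trans kn'.
  (* As [m] is positive, the tree is visibly a [Node], as [card_ParseWords] requires. *)
  rewrite /LeftTurnTree; case: m hm => // m' _ eN.
  by rewrite (card_ParseWords _ eN).
have lt_kn : k < n by rewrite -addn1 (leq_trans _ hn) // leq_add2l.
apply/eqP; rewrite -(eqn_pmul2l (isT : 0 < 6)) classes // mulnCA /a.
rewrite (_ : m + 1 = m + (k + 1) - k); last by rewrite addnCA addKn.
have lt_1nk : 1 < n - k by rewrite ltn_subRL -addnS.
by rewrite classes ?addn1 // subSnn mul1n lt_1nk.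
Qed.
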